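(* Let $C\subseteq \mathbb{F}_3^{12}$ be a ternary $[12,5]$ code such that every codeword $c=(x_1,\ldots,x_{10},y_1,y_2)\in C$ satisfies: (i) $\operatorname{wt}((x_1,\ldots,x_{10}))\equiv y_1y_2 \pmod 3$; (ii) if $c$ is not the zero vector, then $\operatorname{wt}((x_1,\ldots,x_{10}))\ge 3$; (iii) if $\operatorname{wt}((x_1,\ldots,x_{10}))=3$, then $(y_1,y_2)\neq(0,0)$. Then $C$ is SZ-equivalent to one of the seven codes $\mathcal{C}_{12,1},\ldots,\mathcal{C}_{12,7}$ whose generator matrices are listed in the context.
   Context: $\mathbb{F}_3=\{0,1,2\}$ is the field of order 3. A ternary $[n,k]$ code is a $k$-dimensional vector subspace of $\mathbb{F}_3^n$; its elements are called codewords. The weight $\operatorname{wt}(x)$ of a vector $x$ is the number of its nonzero components. A generator matrix of a code is a matrix whose rows form a basis of the code. In the congruence $\operatorname{wt}((x_1,\ldots,x_{10}))\equiv y_1y_2\pmod 3$, the product $y_1y_2\in\mathbb{F}_3$ is regarded as a residue class modulo 3. SZ-equivalence: two ternary $[12,5]$ codes satisfying conditions (i)-(iii) are SZ-equivalent if one is the image of the other under a map $\mathbb{F}_3^{12}\to\mathbb{F}_3^{12}$ of the form $$(x_1,\ldots,x_{10},y_1,y_2)\mapsto((-1)^{\alpha_1}x_{\sigma(1)},\ldots,(-1)^{\alpha_{10}}x_{\sigma(10)},(-1)^{\beta}y_{\tau(1)},(-1)^{\beta}y_{\tau(2)}),$$ where $\alpha_1,\ldots,\alpha_{10},\beta\in\{0,1\}$,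 $\sigma\in S_{10}$, $\tau\in S_2$ (with $S_n$ the symmetric group of degree $n$). The seven codes, each given by the five rows of a generator matrix (each row is written as a string of 12 elements of $\mathbb{F}_3$, grouped as $5+5+2$, the last two entries being the coordinates $y_1,y_2$): $\mathcal{C}_{12,1}$: 10000 12210 12; 01000 01221 12; 00100 10122 12; 00010 21012 12; 00001 22101 12. $\mathcal{C}_{12,2}$: 10000 00111 11; 01000 01011 22; 00100 10101 22; 00010 11001 11; 00001 12210 12. $\mathcal{C}_{12,3}$: 10000 00111 11; 01000 01011 22; 00100 10101 22; 00010 11001 11; 00001 11111 00. $\mathcal{C}_{12,4}$: 10000 00011 01; 01000 01100 01; 00100 10101 22; 00010 11010 22; 00001 11221 01. $\mathcal{C}_{12,5}$: 10000 00011 01; 01000 01100 01; 00100 10101 22; 00010 11010 22; 00001 12222 20. $\mathcal{C}_{12,6}$: 10000 00011 01; 01000 00101 20; 00100 01010 20; 00010 01100 01; 00001 11221 00. $\mathcal{C}_{12,7}$: 10000 00011 01; 01000 00101 20; 00100 01010 20; 00010 01100 01; 00001 01111 12. *)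

(* Defs.v *)
From HB Require Import structures.
From mathcomp Require Import all_boot all_order all_algebra all_fingroup.

Set Implicit Arguments.
Unset Strict Implicit.
Unset Printing Implicit Defensive.

Import GRing.Theory.
Local Open Scope ring_scope.

Definition F3 := 'F_3.

(* F_3^12, split as (x_1, ..., x_10 | y_1, y_2); indices start at 0. *)
Definition word := 'rV[F3]_(10 + 2).

Definition xpart (c : word) : 'rV[F3]_10 := lsubmx c.
Definition ypart (c : word) : 'rV[F3]_2 := rsubmx c.

Definition wt (n : nat) (x : 'rV[F3]_n) : nat := #|[set i | x 0 i != 0]|.

Definition SZ_map (alpha : {ffun 'I_10 -> bool}) (beta : bool)
    (sigma : 'S_10) (tau : 'S_2) (c : word) : word :=
  row_mx (\row_i ((-1) ^+ alpha i * xpart c 0 (sigma i)))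
         (\row_j ((-1) ^+ beta * ypart c 0 (tau j))).

(* SZ-equivalence compares [12,5] codes subject to conditions on wt (xpart c)
   and ypart c. The maps SZ_map preserve the dimension, wt (xpart c), the
   product of the two entries of ypart c and whether ypart c is zero; they form
   a group, so the relation is symmetric and needs no restriction on C, D. *)
Definition SZ_equiv (C D : {vspace word}) : Prop :=
  exists (alpha : {ffun 'I_10 -> bool}) (beta : bool) (sigma : 'S_10)
         (tau : 'S_2),
    [set d in D] = [set SZ_map alpha beta sigma tau c | c in C].

Definition word_of_digits (s : seq nat) : word := \row_j (nth 0%N s j)%:R.

Definition code_of_rows (rows : seq (seq nat)) : {vspace word} :=
  <<map word_of_digits rows>>%VS.

Definition C12_1 : {vspace word} := code_of_rows
  [:: [:: 1;0;0;0;0; 1;2;2;1;0; 1;2];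
      [:: 0;1;0;0;0; 0;1;2;2;1; 1;2];
      [:: 0;0;1;0;0; 1;0;1;2;2; 1;2];
      [:: 0;0;0;1;0; 2;1;0;1;2; 1;2];
      [:: 0;0;0;0;1; 2;2;1;0;1; 1;2] ]%N.

Definition C12_2 : {vspace word} := code_of_rows
  [:: [:: 1;0;0;0;0; 0;0;1;1;1; 1;1];
      [:: 0;1;0;0;0; 0;1;0;1;1; 2;2];
      [:: 0;0;1;0;0; 1;0;1;0;1; 2;2];
      [:: 0;0;0;1;0; 1;1;0;0;1; 1;1];
      [:: 0;0;0;0;1; 1;2;2;1;0; 1;2] ]%N.

Definition C12_3 : {vspace word} := code_of_rows
  [:: [:: 1;0;0;0;0; 0;0;1;1;1; 1;1];
      [:: 0;1;0;0;0; 0;1;0;1;1; 2;2];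
      [:: 0;0;1;0;0; 1;0;1;0;1; 2;2];
      [:: 0;0;0;1;0; 1;1;0;0;1; 1;1];
      [:: 0;0;0;0;1; 1;1;1;1;1; 0;0] ]%N.

Definition C12_4 : {vspace word} := code_of_rows
  [:: [:: 1;0;0;0;0; 0;0;0;1;1; 0;1];
      [:: 0;1;0;0;0; 0;1;1;0;0; 0;1];
      [:: 0;0;1;0;0; 1;0;1;0;1; 2;2];
      [:: 0;0;0;1;0; 1;1;0;1;0; 2;2];
      [:: 0;0;0;0;1; 1;1;2;2;1; 0;1] ]%N.

Definition C12_5 : {vspace word} := code_of_rows
  [:: [:: 1;0;0;0;0; 0;0;0;1;1; 0;1];
      [:: 0;1;0;0;0; 0;1;1;0;0; 0;1];
      [:: 0;0;1;0;0; 1;0;1;0;1; 2;2];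
      [:: 0;0;0;1;0; 1;1;0;1;0; 2;2];
      [:: 0;0;0;0;1; 1;2;2;2;2; 2;0] ]%N.

Definition C12_6 : {vspace word} := code_of_rows
  [:: [:: 1;0;0;0;0; 0;0;0;1;1; 0;1];
      [:: 0;1;0;0;0; 0;0;1;0;1; 2;0];
      [:: 0;0;1;0;0; 0;1;0;1;0; 2;0];
      [:: 0;0;0;1;0; 0;1;1;0;0; 0;1];
      [:: 0;0;0;0;1; 1;1;2;2;1; 0;0] ]%N.

Definition C12_7 : {vspace word} := code_of_rows
  [:: [:: 1;0;0;0;0; 0;0;0;1;1; 0;1];
      [:: 0;1;0;0;0; 0;0;1;0;1; 2;0];
      [:: 0;0;1;0;0; 0;1;0;1;0; 2;0];
      [:: 0;0;0;1;0; 0;1;1;0;0; 0;1];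
      [:: 0;0;0;0;1; 0;1;1;1;1; 1;2] ]%N.

(* Main.v *)
From HB Require Import structures.
Require Import Defs.
From mathcomp Require Import all_boot all_order all_algebra all_fingroup.

(** Permuting coordinates and changing signs brings [C] into a systematic
    form, and only a few hundred systematic generator matrices satisfy the
    three conditions; each of them generates a copy of one of the seven codes.

    In more detail, condition (ii) makes the projection of [C] on the ten
    [x]-coordinates injective, so that there is an information set of five
    [x]-coordinates and a basis of [C] dual to it ([information_set]).  Up to
    SZ-equivalence [C] thus has a generator matrix [[ I | A | Y ]] with [I] the
    identity of size 5.  Three symmetries remain and are used up as follows
    ([systematic_form]): the basis is sorted by the [x]-weight; each row is
    multiplied by a sign which makes the leading digit of its [y]-part 1 (the
    sign spoilt in the identity block is repaired by a sign change of that
    column); and the columns of [A], of which signs and order are free, get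
    leading digit 1 and are sorted lexicographically.

    A backtracking search ([search]) builds such matrices row by row, keeping a
    row only if all its combinations with the previous rows satisfy the
    conditions.  It reaches 506 complete matrices.  For each of them, a second
    search ([embeds]) finds in one of the seven codes five words which have the
    same [x]-columns up to order and signs, and the same [y]-columns up to
    order.  Equality of columns in this sense is what an SZ-equivalence between
    the generated codes needs ([rows_equiv_SZ]), and a dimension count shows
    that the five words generate the whole of the listed code.

    Both searches compute with words written as lists of the digits 0, 1, 2. *)

Set Implicit Arguments.
Unset Strict Implicit.
Unset Printing Implicit Defensive.

Import GRing.Theory.
Local Open Scope ring_scope.

(** * Arithmetic on ternary digits *)

(** The last branch, like those of [oppd] and [nzd] below, makes the operation
    agree with [F3] on all natural numbers, so that passing to [F3] requires no
    bound on the digits. *)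
Definition addd (a b : nat) : nat :=
  match a, b with
  | 0, _ => b | _, 0 => a
  | 1, 1 => 2 | 1, 2 => 0 | 2, 1 => 0 | 2, 2 => 1
  | _, _ => a + b
  end%N.

Definition oppd (a : nat) : nat :=
  match a with 0 => 0 | 1 => 2 | 2 => 1 | _ => a + a end%N.

Definition nzd (a : nat) : bool :=
  match a with 0 => false | 1 | 2 => true | _ => a %% 3 != 0 end%N.

Lemma adddE a b : (addd a b)%:R = a%:R + b%:R :> F3.
Proof.
case: a => [|[|[|a]]]; case: b => [|[|[|b]]];
  by rewrite /addd ?natrD ?add0r ?addr0 //; apply/val_inj.
Qed.

Lemma oppdE a : (oppd a)%:R = - a%:R :> F3.
Proof.
apply/eqP; rewrite -subr_eq0 opprK.
case: a => [|[|[|a]]] //; rewrite /oppd; move: a.+3 => n.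
rewrite natrD -mulr2n -mulrSr -mulrnA mulnC mulrnA.
by rewrite (_ : 1 *+ 3 = 0) ?mul0rn //; apply/val_inj.
Qed.

Lemma nzdE a : nzd a = (a%:R != 0 :> F3).
Proof.
have -> : nzd a = (a %% 3 != 0)%N by case: a => [|[|[|a]]].
by rewrite -val_eqE /= (val_Fp_nat (p := 3)).
Qed.

Lemma oppd_lt3 a : (a < 3)%N -> (oppd a < 3)%N.
Proof. by case: a => [|[|[|a]]]. Qed.

Lemma nzd_opp a : nzd (oppd a) = nzd a.
Proof. by rewrite !nzdE oppdE oppr_eq0. Qed.

(** The shorter word is padded with zeros; in particular [[::]] is a zero
    word. *)
Fixpoint addw (u v : seq nat) : seq nat :=
  match u, v with
  | [::], _ => v
  | _, [::] => u
  | a :: u', b :: v' => addd a b :: addw u' v'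
  end.

Definition oppw (u : seq nat) : seq nat := map oppd u.

Lemma nth_addw u v j : nth 0%N (addw u v) j = addd (nth 0%N u j) (nth 0%N v j).
Proof.
elim: u v j => [|a u IHu] v j; first by rewrite /= nth_nil.
case: v => [|b v]; last by case: j => [|j] //=; exact: IHu.
by rewrite /= (nth_nil 0%N j); case: (nth _ _ _) => [|[|[|x]]].
Qed.

Lemma nth_oppw u j : nth 0%N (oppw u) j = oppd (nth 0%N u j).
Proof. by elim: u j => [|a u IHu] [|j] //=. Qed.

Lemma word_of_digitsD u v :
  word_of_digits (addw u v) = word_of_digits u + word_of_digits v.
Proof. by apply/rowP => j; rewrite !mxE nth_addw adddE. Qed.

Lemma word_of_digitsN u : word_of_digits (oppw u) = - word_of_digits u.
Proof. by apply/rowP => j; rewrite !mxE nth_oppw oppdE. Qed.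

Definition digits (c : word) : seq nat := [seq (c 0 j : nat) | j <- enum 'I_12].

Lemma size_digits c : size (digits c) = 12.
Proof. by rewrite size_map size_enum_ord. Qed.

Lemma nth_digits c (j : 'I_12) : nth 0%N (digits c) j = c 0 j.
Proof. by rewrite (nth_map j) ?size_enum_ord ?nth_ord_enum. Qed.

Lemma digitsK c : word_of_digits (digits c) = c.
Proof. by apply/rowP => j; rewrite mxE nth_digits natr_Zp. Qed.

Lemma xpart_word_of_digits u i :
  xpart (word_of_digits u) 0 i = (nth 0%N u i)%:R.
Proof. by rewrite !mxE. Qed.

Lemma ypart_word_of_digits u i :
  ypart (word_of_digits u) 0 i = (nth 0%N u (10 + i))%:R.
Proof. by rewrite !mxE. Qed.

Lemma word_split (c d : word) : xpart c = xpart d -> ypart c = ypart d -> c = d.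
Proof.
move=> eq_x eq_y; rewrite -[c]hsubmxK -[d]hsubmxK.
by congr row_mx.
Qed.

(** * SZ-maps and admissible words *)

Section SZ.
Variables (alpha : {ffun 'I_10 -> bool}) (beta : bool).
Variables (sigma : 'S_10) (tau : 'S_2).
Local Notation f := (SZ_map alpha beta sigma tau).

Lemma xpart_SZ c i : xpart (f c) 0 i = (-1) ^+ alpha i * xpart c 0 (sigma i).
Proof. by rewrite /SZ_map /xpart row_mxKl mxE. Qed.

Lemma ypart_SZ c i : ypart (f c) 0 i = (-1) ^+ beta * ypart c 0 (tau i).
Proof. by rewrite /SZ_map /ypart row_mxKr mxE. Qed.

Fact SZ_map_linear : linear f.
Proof.
have xD a c d i : xpart (a *: c + d) 0 i = a * xpart c 0 i + xpart d 0 i.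
  by rewrite !mxE.
have yD a c d i : ypart (a *: c + d) 0 i = a * ypart c 0 i + ypart d 0 i.
  by rewrite !mxE.
move=> a c d; apply: word_split; apply/rowP => i.
  by rewrite xD !xpart_SZ xD mulrDr mulrCA.
by rewrite yD !ypart_SZ yD mulrDr mulrCA.
Qed.

HB.instance Definition _ :=
  GRing.isLinear.Build F3 word word *:%R f SZ_map_linear.

Lemma SZ_imageP (C D : {vspace word}) :
  [set d in D] = [set f c | c in C] <-> D = (linfun f @: C)%VS.
Proof.
have imE d : d \in [set f c | c in C] = (d \in linfun f @: C)%VS.
  by apply/imsetP/memv_imgP => -[c Cc ->]; exists c; rewrite ?lfunE.
by split=> [/setP eqD | ->]; [apply/vspaceP | apply/setP] => d;
  rewrite ?imE ?inE // -imE -eqD inE.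
Qed.

Lemma wt_SZ c : wt (xpart (f c)) = wt (xpart c).
Proof.
rewrite /wt -[RHS](card_preimset _ (@perm_inj _ sigma)).
by apply: eq_card => i; rewrite !inE xpart_SZ mulf_eq0 signr_eq0.
Qed.

Lemma ypart_SZ_mul c :
  ypart (f c) 0 0 * ypart (f c) 0 1 = ypart c 0 0 * ypart c 0 1.
Proof.
rewrite !ypart_SZ mulrACA -expr2 sqrr_sign mul1r.
have prod2 (F : 'I_2 -> F3) : F 0 * F 1 = \prod_i F i.
  rewrite big_ord_recl big_ord1; congr (F _ * F _); exact/val_inj.
rewrite (prod2 (fun j => ypart c 0 (tau j))) (prod2 (ypart c 0)).
by rewrite [RHS](reindex_inj (@perm_inj _ tau)).
Qed.

Lemma ypart_SZ_eq0 c : (ypart (f c) == 0) = (ypart c == 0).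
Proof.
apply/eqP/eqP => y0; apply/rowP => i; last first.
  by rewrite ypart_SZ y0 !mxE mulr0.
move/rowP/(_ (tau^-1 i)%g): y0; rewrite ypart_SZ permKV !mxE => /eqP.
by rewrite mulf_eq0 signr_eq0 => /eqP.
Qed.
End SZ.

(** Conditions (i)-(iii), word by word. *)
Definition admissible (c : word) : Prop :=
  [/\ (wt (xpart c))%:R = ypart c 0 0 * ypart c 0 1 :> F3,
      c != 0 -> (3 <= wt (xpart c))%N
    & wt (xpart c) = 3%N -> ypart c != 0].

Lemma admissible_SZ_equiv (C D : {vspace word}) : SZ_equiv C D ->
  {in C, forall c, admissible c} -> {in D, forall d, admissible d}.
Proof.
move=> [alpha [beta [sigma [tau eqDC]]]] admC d Dd.
have: d \in [set d in D] by rewrite inE.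
rewrite eqDC => /imsetP[c Cc ->].
have [ci cii ciii] := admC c Cc.
split; rewrite ?wt_SZ ?ypart_SZ_mul ?ypart_SZ_eq0 //.
by move=> fc_nz; apply: cii; apply: contraNneq fc_nz => ->; rewrite linear0.
Qed.

Lemma SZ_equiv_dim C D : SZ_equiv C D -> (\dim D <= \dim C)%N.
Proof.
move=> [alpha [beta [sigma [tau eqDC]]]].
move/SZ_imageP: eqDC => ->; set f := linfun _.
by rewrite -[\dim C](limg_ker_dim f) leq_addl.
Qed.

Definition wt10 (u : seq nat) : nat := count nzd (take 10 u).

Lemma wt10E u : wt10 u = count (fun j => nzd (nth 0%N u j)) (iota 0 10).
Proof.
rewrite /wt10; elim: 10%N u => [|n IHn] [|a u] //=.
  by rewrite (@eq_count _ _ pred0) ?count_pred0 // => j; rewrite nth_nil.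
by rewrite IHn (iotaDl 1 0 n) count_map.
Qed.

Lemma wt_xpart u : wt (xpart (word_of_digits u)) = wt10 u.
Proof.
rewrite /wt cardE {1}/enum_mem size_filter -enumT wt10E -val_enum_ord count_map.
by apply: eq_count => i; rewrite /= inE xpart_word_of_digits nzdE.
Qed.

(** The test [w == 0] admits the zero word; a nonzero admissible word has
    weight at least 3. *)
Definition okword (u : seq nat) : bool :=
  let w := wt10 u in let y1 := nth 0%N u 10 in let y2 := nth 0%N u 11 in
  (w == 0)%N ||
  [&& (3 <= w)%N, w %% 3 == (y1 * y2) %% 3 & (w == 3) ==> nzd y1 || nzd y2]%N.

Lemma admissible_okword u : admissible (word_of_digits u) -> okword u.
Proof.
rewrite /admissible wt_xpart => -[ui uii uiii].
rewrite /okword; case: (posnP (wt10 u)) => [-> //|wt_gt0]; apply/orP; right.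
have u_nz : word_of_digits u != 0.
  apply: contraTneq wt_gt0 => u0.
  rewrite -wt_xpart u0 -leqNgt leqn0 /wt cards_eq0.
  by apply/eqP/setP => i; rewrite !inE !mxE eqxx.
rewrite uii //=; apply/andP; split.
  move: ui; rewrite !ypart_word_of_digits -natrM => /(congr1 (@nat_of_ord _)).
  by rewrite !(val_Fp_nat (p := 3)) // => /eqP.
apply/implyP => /eqP/uiii; apply: contraR.
rewrite negb_or !nzdE !negbK => /andP[/eqP y1 /eqP y2].
apply/eqP/rowP => -[[|[|]] // ?]; rewrite ypart_word_of_digits ?y1 ?y2 mxE //.
Qed.

(** * Generator matrices up to the order and the signs of their columns *)

Fixpoint lead1 (s : seq nat) : bool :=
  match s with
  | 0 :: s' => lead1 s'
  | a :: _ => a == 1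
  | [::] => true
  end%N.

(** The representative, among [s] and its opposite, with leading digit 1. *)
Definition normw (s : seq nat) : seq nat := if lead1 s then s else oppw s.

Lemma normw_lead1 s : all (gtn 3) s -> lead1 (normw s).
Proof.
rewrite /normw; case: ifP => //; elim: s => [|[|[|[|a]]] s IHs] //=.
Qed.

Lemma normw_sign s :
  exists b : bool, forall i,
    (nth 0%N (normw s) i)%:R = (-1) ^+ b * (nth 0%N s i)%:R :> F3.
Proof.
exists (~~ lead1 s) => i; rewrite /normw.
case: (lead1 s); first by rewrite mul1r.
by rewrite nth_oppw oppdE expr1 mulN1r.
Qed.

Lemma normw_nzd s i : nzd (nth 0%N (normw s) i) = nzd (nth 0%N s i).
Proof. by have [b sb] := normw_sign s; rewrite !nzdE sb mulf_eq0 signr_eq0. Qed.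

Definition digit_col (G : seq (seq nat)) (j : nat) : seq nat :=
  [seq nth 0%N r j | r <- G].

(** Signs of columns are free, hence the normalization. *)
Definition xcols (G : seq (seq nat)) : seq (seq nat) :=
  [seq normw (digit_col G j) | j <- iota 0 10].

Lemma nth_digit_col G j i :
  nth 0%N (digit_col G j) i = nth 0%N (nth [::] G i) j.
Proof.
have [lt_i | le_i] := ltnP i (size G); first by rewrite (nth_map [::]).
by rewrite !nth_default ?size_map // nth_default.
Qed.

Definition ydig (u : seq nat) : nat * nat := (nth 0 u 10, nth 0 u 11)%N.

Definition swap_pair (p : nat * nat) : nat * nat := (p.2, p.1).

(** The [y]-columns are compared without signs because a sign common to both of
    them can be moved to the [x]-columns by multiplying all rows by -1. *)
Definition rows_equiv (G H : seq (seq nat)) : Prop :=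
  [/\ size G = size H, perm_eq (xcols G) (xcols H)
    & map ydig G = map ydig H
      \/ map ydig G = [seq swap_pair (ydig r) | r <- H]].

Lemma rows_equiv_sym G H : rows_equiv G H -> rows_equiv H G.
Proof.
move=> [szGH colGH yGH]; split; rewrite 1?perm_sym //; case: yGH => yGH.
  by left.
right; rewrite map_comp yGH -map_comp.
by apply: eq_map => r /=; rewrite /swap_pair.
Qed.

Lemma rows_equiv_trans G H K :
  rows_equiv G H -> rows_equiv H K -> rows_equiv G K.
Proof.
move=> [szGH colGH yGH] [szHK colHK yHK].
have swapK : involutive swap_pair by case.
set swapped := [seq swap_pair (ydig r) | r <- H] in yGH.
have swapH :
    swapped = map ydig K \/ swapped = [seq swap_pair (ydig r) | r <- K].
  rewrite /swapped (map_comp swap_pair).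
  case: yHK => yHK; rewrite yHK; [right | left].
    by rewrite -map_comp.
  by rewrite -map_comp; apply: eq_map => r /=; rewrite swapK.
split; [by rewrite szGH | exact: perm_trans colGH colHK |].
by case: yGH => ->; [| case: swapH; [left | right]].
Qed.

(** A bijection between equal multisets of columns is the permutation [sigma],
    and comparing two columns with their common normal form gives the sign.  The
    resulting SZ-map takes each row to the corresponding row, hence, being
    linear, the span to the span. *)
Lemma rows_equiv_SZ G H :
  rows_equiv G H -> SZ_equiv (code_of_rows G) (code_of_rows H).
Proof.
move=> [szGH colGH yGH].
pose N G' (i : 'I_10) := normw (digit_col G' i).
have xcolsE G' : xcols G' = [seq N G' i | i <- enum 'I_10].
  by rewrite /xcols -val_enum_ord -map_comp.
have [sigma eq_sigma] : exists sigma : 'S_10, forall i, N H i = N G (sigma i).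
  have : perm_eq [tuple N H i | i < 10] [tuple N G i | i < 10].
    by rewrite perm_sym /= -!xcolsE.
  move=> /tuple_permP[sigma eqHG]; exists sigma => i.
  have : tnth [tuple N H i | i < 10] i =
     tnth [tuple tnth [tuple N G i | i < 10] (sigma i) | i < 10] i.
    congr tnth; exact/val_inj.
  by rewrite !tnth_mktuple.
pose entry G' r (j : nat) : F3 := (nth 0%N (nth [::] G' r) j)%:R.
have [b b_P] : exists b : 'I_10 -> bool, forall (i : 'I_10) r,
    entry H r i = (-1) ^+ b i * entry G r (sigma i).
  suff /fin_all_exists[b bP] (i : 'I_10) : exists b : bool, forall r,
      entry H r i = (-1) ^+ b * entry G r (sigma i) by exists b.
  have [bH bHP] := normw_sign (digit_col H i).
  have [bG bGP] := normw_sign (digit_col G (sigma i)).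
  exists (bH (+) bG) => r.
  rewrite /entry -!nth_digit_col signr_addb -mulrA -bGP.
  rewrite -[normw (digit_col G _)]/(N G _) -eq_sigma bHP.
  by rewrite mulrA -expr2 sqrr_sign mul1r.
have [tau tau_P] : exists tau : 'S_2, forall (i : 'I_2) r, (r < size G)%N ->
    nth 0%N (nth [::] H r) (10 + i) = nth 0%N (nth [::] G r) (10 + tau i).
  case: yGH => yGH; [exists 1%g | exists (tperm 0 1)] => i r lt_r;
    move/(congr1 (fun s => nth (0, 0)%N s r)): yGH;
    rewrite !(nth_map [::]) -?szGH // => -[y1 y2].
    by rewrite perm1; case: i => [[|[|]]].
  case: i => [[|[|]]] // ?.
    rewrite (_ : Ordinal _ = 0) ?tpermL //; exact/val_inj.
  rewrite (_ : Ordinal _ = 1) ?tpermR //; exact/val_inj.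
exists [ffun i => b i], false, sigma, tau.
apply/SZ_imageP; rewrite limg_span; congr span; apply: (@eq_from_nth _ 0).
  by rewrite !size_map.
move=> r; rewrite !size_map => lt_r.
rewrite -map_comp !(nth_map [::]) ?szGH //= lfunE /=.
apply: word_split; apply/rowP => i.
  by rewrite xpart_SZ !xpart_word_of_digits ffunE; exact: b_P.
by rewrite ypart_SZ !ypart_word_of_digits mul1r tau_P ?szGH.
Qed.

(** * Systematic generator matrices *)

(** The matrix of [f] in a basis of [U] has rank [k], so [k] of its columns
    form an invertible matrix; its inverse expresses the basis dual to these
    coordinates. *)
Lemma information_set (F : fieldType) (V : vectType F) (n k : nat)
    (f : 'Hom(V, 'rV[F]_n)) (U : {vspace V}) :
  \dim U = k -> (U :&: lker f = 0)%VS ->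
  exists (s : 'I_k -> 'I_n) (e : 'I_k -> V),
    U = <<[seq e i | i <- enum 'I_k]>>%VS /\
    (forall i j, f (e i) 0 (s j) = (i == j)%:R).
Proof.
move=> <- ker0; set b := vbasis U; have basisU := vbasisP U.
pose A : 'M[F]_(\dim U, n) := \matrix_i f b`_i.
have comb v : v *m A = f (\sum_i v 0 i *: b`_i).
  rewrite mulmx_sum_row linear_sum; apply: eq_bigr => i _.
  by rewrite linearZ rowK.
have comb_in (v : 'rV_(\dim U)) : \sum_i v 0 i *: b`_i \in U.
  apply: memv_suml => i _.
  by rewrite memvZ // vbasis_mem // mem_nth ?size_tuple.
have freeA : row_free A.
  apply: inj_row_free => v; rewrite comb => fv0.
  have: \sum_i v 0 i *: b`_i \in (U :&: lker f)%VS.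
    by rewrite memv_cap comb_in memv_ker fv0 eqxx.
  rewrite ker0 memv0 => /eqP v0; apply/rowP => i; rewrite mxE.
  by move/freeP: (basis_free basisU); apply.
have fullAT : row_full A^T by rewrite /row_full mxrank_tr.
pose s := fullrankfun fullAT.
have B_unit := fullrowsub_unit fullAT; set B := rowsub _ _ in B_unit.
pose N := (invmx B)^T.
pose e i := \sum_l row i N 0 l *: b`_l.
have e_s i j : f (e i) 0 (s j) = (i == j)%:R.
  rewrite -comb -row_mul mxE.
  have -> : (N *m A) i (s j) = (N *m B^T) i j.
    by rewrite !mxE; apply: eq_bigr => l _; rewrite !mxE.
  by rewrite /N -trmx_mul mulmxV // trmx1 mxE.
exists s, e; split=> //; apply/esym/eqP; rewrite eqEdim; apply/andP; split.
  by apply/span_subvP => _ /mapP[i _ ->]; apply: comb_in.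
suff /eqP -> : free [tuple e i | i < \dim U] by rewrite size_tuple.
apply/freeP => a /(congr1 (f : _ -> _)); rewrite linear_sum linear0 => sum0 j.
move/rowP/(_ (s j)): sum0; rewrite summxE mxE (bigD1 j) // big1 => [|i ne_ij].
  rewrite -tnth_nth tnth_mktuple linearZ mxE e_s eqxx mulr1 => <-.
  by rewrite [RHS]addr0.
by rewrite -tnth_nth tnth_mktuple linearZ mxE e_s (negPf ne_ij) mulr0.
Qed.

Lemma sort_perm (n : nat) (w : 'I_n -> nat) :
  exists p : 'S_n, forall i j : 'I_n, (i <= j)%N -> (w (p i) <= w (p j))%N.
Proof.
have : perm_eq (sort_tuple leq [tuple w i | i < n]) [tuple w i | i < n].
  by rewrite perm_sort.
move=> /tuple_permP[p def_p]; exists p => i j le_ij.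
have nthE (l : 'I_n) : nth 0%N (sort leq [tuple w i | i < n]) l = w (p l).
  by rewrite -[sort _ _]/(tval (sort_tuple _ _)) def_p -tnth_nth !tnth_mktuple.
rewrite -!nthE; apply: (sorted_leq_nth leq_trans leqnn) => //.
- exact: (sort_sorted leq_total).
- by rewrite inE size_sort size_tuple.
- by rewrite inE size_sort size_tuple.
Qed.

Fixpoint lexle (s t : seq nat) : bool :=
  match s, t with
  | a :: s', b :: t' => (a < b)%N || (a == b) && lexle s' t'
  | _, _ => true
  end.

(** The columns 5 to 9 are those of the block [A]. *)
Definition normal_cols (G : seq (seq nat)) : bool :=
  let cs := [seq digit_col G j | j <- iota 5 5] in
  all lead1 cs && sorted lexle cs.

Fixpoint tails (n : nat) : seq (seq nat) :=
  if n is n'.+1 then [seq a :: s | a <- [:: 0; 1; 2]%N, s <- tails n']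
  else [:: [::]].

Lemma mem_tails s : all (gtn 3) s -> s \in tails (size s).
Proof.
elim: s => // a s IHs /andP[lt_a /IHs s_tails].
apply/allpairsP; exists (a, s); split=> //.
by case: a lt_a => [|[|[|]]].
Qed.

Definition unit5 (i : nat) : seq nat := [seq (j == i : nat) | j <- iota 0 5].

Lemma lead1_take k s : lead1 s -> lead1 (take k s).
Proof. by elim: s k => [|[|a] s IHs] [|k] //= /IHs. Qed.

Lemma lexle_take k s t : lexle s t -> lexle (take k s) (take k t).
Proof.
elim: s k t => [|a s IHs] [|k] [|b t] //= /orP[-> // | /andP[-> /IHs ->]].
by rewrite orbT.
Qed.

Lemma lexle_total : total lexle.
Proof.
elim=> [|a s IHs] [|b t] //=; case: (ltngtP a b) => //= _; exact: IHs.
Qed.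

Lemma size_normw s : size (normw s) = size s.
Proof. by rewrite /normw; case: ifP; rewrite ?size_map. Qed.

Lemma normw_id s : lead1 s -> normw s = s.
Proof. by rewrite /normw => ->. Qed.

Lemma all_oppw s : all (gtn 3) s -> all (gtn 3) (oppw s).
Proof. by rewrite all_map; apply: sub_all => a /oppd_lt3. Qed.

Lemma all_normw s : all (gtn 3) s -> all (gtn 3) (normw s).
Proof. by rewrite /normw; case: ifP => // _; apply: all_oppw. Qed.

Lemma wt10_oppw u : wt10 (oppw u) = wt10 u.
Proof.
by rewrite /wt10 -map_take count_map; apply: eq_count => a; apply: nzd_opp.
Qed.

Lemma wt10_xcols G i : (i < size G)%N ->
  wt10 (nth [::] G i) = count (fun c => nzd (nth 0%N c i)) (xcols G).
Proof.
move=> lt_i; rewrite wt10E /xcols count_map; apply: eq_count => j /=.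
by rewrite normw_nzd nth_digit_col.
Qed.

Definition norm_row (u : seq nat) : seq nat :=
  if lead1 (drop 10 u) then u else oppw u.

Lemma norm_row_sign u : exists b : bool,
  word_of_digits (norm_row u) = (-1) ^+ b *: word_of_digits u.
Proof.
exists (~~ lead1 (drop 10 u)); rewrite /norm_row; case: ifP => _.
  by rewrite scale1r.
by rewrite word_of_digitsN expr1 scaleN1r.
Qed.

Lemma drop_norm_row u : drop 10 (norm_row u) = normw (drop 10 u).
Proof. by rewrite /norm_row /normw; case: ifP => // _; rewrite -map_drop. Qed.

Lemma all_digits c : all (gtn 3) (digits c).
Proof. by apply/allP => _ /mapP[j _ ->]; apply: ltn_ord. Qed.

Lemma normw_unit5 c i : size c = 5 -> (i < 5)%N -> all (gtn 3) c ->
  (forall k, (k < 5)%N -> nzd (nth 0%N c k) = (k == i)) -> normw c = unit5 i.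
Proof.
case: c => [|x0 [|x1 [|x2 [|x3 [|x4 [|? ?]]]]]] //= _ lt_i.
move=> /and5P[x0_lt x1_lt x2_lt x3_lt /andP[x4_lt _]] x_nz.
move: (x_nz 0%N isT) (x_nz 1%N isT) (x_nz 2%N isT).
move: (x_nz 3%N isT) (x_nz 4%N isT).
case: i lt_i {x_nz} => [|[|[|[|[|]]]]] // _ /=;
  case: x0 x0_lt => [|[|[|]]] // _; case: x1 x1_lt => [|[|[|]]] // _;
  case: x2 x2_lt => [|[|[|]]] // _; case: x3 x3_lt => [|[|[|]]] // _;
  case: x4 x4_lt => [|[|[|]]] //.
Qed.

(** The normal columns are stated for all initial segments of the matrix, in
    the form in which a search that adds one row after the other tests them. *)
Record systematic (M : seq (seq nat)) : Prop := Systematic {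
  systematic_size : size M = 5;
  systematic_row : forall i, (i < 5)%N ->
    nth [::] M i \in [seq unit5 i ++ t | t <- tails 7];
  systematic_y : forall i, (i < 5)%N -> lead1 (drop 10 (nth [::] M i));
  systematic_cols : forall k, normal_cols (take k M);
  systematic_wt : forall i j, (i <= j < 5)%N ->
    (wt10 (nth [::] M i) <= wt10 (nth [::] M j))%N
}.

(** The columns of the sorted and sign-adjusted dual basis split into those of
    the information set, which normalize to unit columns, and five others; [M]
    is the matrix whose columns are the unit columns followed by the sorted
    normal forms of the others. *)
Lemma systematic_form (C : {vspace word}) : \dim C = 5%N ->
  (forall c, c \in C -> xpart c = 0 -> c = 0) ->
  exists G M, [/\ C = code_of_rows G, rows_equiv G M & systematic M].
Proof.
move=> dimC xinj.
have ker0 : (C :&: lker (linfun (@lsubmx F3 1 10 2)) = 0)%VS.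
  apply/eqP; rewrite -subv0; apply/subvP => c.
  rewrite memv_cap memv_ker lfunE /= memv0 => /andP[Cc /eqP c0].
  by rewrite (xinj c).
have [s [e [Ce e_s']]] := information_set dimC ker0.
have e_s i j : xpart (e i) 0 (s j) = (i == j)%:R.
  by rewrite -e_s' lfunE.
have [p p_wt] := sort_perm (fun i => wt (xpart (e i))).
pose row i := norm_row (digits (e (p i))).
pose G := [seq row i | i <- enum 'I_5].
have szG : size G = 5%N by rewrite size_map size_enum_ord.
have nthG (i : 'I_5) : nth [::] G i = row i.
  by rewrite (nth_map i) ?size_enum_ord ?nth_ord_enum.
have row_sign i :
    exists b : bool, word_of_digits (row i) = (-1) ^+ b *: e (p i).
  have [b def_b] := norm_row_sign (digits (e (p i))).
  by exists b; rewrite def_b digitsK.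
have CG : C = code_of_rows G.
  apply/eqP; rewrite Ce eqEsubv; apply/andP; split; apply/span_subvP => u.
    move=> /mapP[i _ ->].
    have [b def_b] := row_sign (p^-1 i)%g; rewrite permKV in def_b.
    have -> : e i = (-1) ^+ b *: word_of_digits (row (p^-1 i)%g).
      by rewrite def_b scalerA -expr2 sqrr_sign scale1r.
    by apply/memvZ/memv_span; do 2!apply: map_f; rewrite mem_enum.
  move=> /mapP[_ /mapP[i _ ->] ->]; have [b ->] := row_sign i.
  by apply/memvZ/memv_span; apply: map_f; rewrite mem_enum.
have row_lt3 i j : (nth 0 (row i) j < 3)%N.
  have [lt_j|le_j] := ltnP j (size (row i)); last by rewrite nth_default.
  have all_row : all (gtn 3) (row i).
    by rewrite /row /norm_row; case: ifP => _; rewrite ?all_oppw ?all_digits.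
  exact: (allP all_row _ (mem_nth 0%N lt_j)).
pose s' i := s (p i); pose N j := normw (digit_col G j).
(* The row signs only affect the sign of a column of the information set. *)
have N_s' i : N (s' i) = unit5 i.
  apply: normw_unit5 => //; first by rewrite size_map.
    by apply/allP => _ /mapP[_ /mapP[k _ ->] ->]; apply: row_lt3.
  move=> k lt_k; rewrite nth_digit_col (nthG (Ordinal lt_k)) nzdE.
  rewrite -xpart_word_of_digits; have [b ->] := row_sign (Ordinal lt_k).
  rewrite /xpart linearZ mxE mulf_eq0 signr_eq0 [lsubmx _ _ _]e_s.
  rewrite (inj_eq perm_inj) -[(k == i)%N]/(Ordinal lt_k == i).
  by case: (_ == i); rewrite ?oner_eq0 ?eqxx.
have s'_inj : injective s'.
  move=> i j eq_s; apply: (@perm_inj _ p); apply/eqP.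
  have := e_s (p i) (p i); rewrite [s (p i)]eq_s e_s eqxx.
  by case: eqP => // _ /eqP; rewrite eq_sym oner_eq0.
pose js := [seq j <- enum 'I_10 | j \notin codom s'].
have perm_js : perm_eq (enum 'I_10) ([seq s' i | i <- enum 'I_5] ++ js).
  apply: uniq_perm; rewrite ?enum_uniq //.
    rewrite cat_uniq map_inj_uniq // enum_uniq filter_uniq ?enum_uniq //= andbT.
    by apply/hasPn => j; rewrite mem_filter => /andP[].
  move=> j; rewrite mem_cat -codomE mem_enum (mem_filter _ j (enum _)) mem_enum.
  by rewrite andbT; case: (j \in _).
have sz_js : size js = 5.
  have := size_cat (map s' (enum 'I_5)) js.
  rewrite -(perm_size perm_js) (size_map s') !size_enum_ord => sz.
  exact: (@addnI 5 _ 5 (esym sz)).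
pose cs := sort lexle [seq N j | j : 'I_10 <- js].
pose units := [seq unit5 i | i <- iota 0 5].
have xcolsG : perm_eq (xcols G) (units ++ cs).
  rewrite /xcols -val_enum_ord -map_comp.
  apply: perm_trans (perm_map _ perm_js) _.
  rewrite map_cat -map_comp /units -val_enum_ord -map_comp.
  by rewrite (@eq_map _ _ _ (unit5 \o val) N_s') perm_cat2l perm_sym perm_sort.
have sz_cs : size cs = 5 by rewrite size_sort size_map.
have size_N j : size (N j) = 5 by rewrite size_normw size_map.
have G_lt3 j : all (gtn 3) (digit_col G j).
  by apply/allP => _ /mapP[_ /mapP[k _ ->] ->]; apply: row_lt3.
(* The rows of [M] are read off the columns, the [y]-part being that of [G]. *)
pose ucs := units ++ cs.
have sz_ucs : size ucs = 10 by rewrite size_cat sz_cs.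
have ucs_lead1 c : c \in ucs -> lead1 c.
  rewrite -(perm_mem xcolsG) => /mapP[j _ ->].
  by apply/normw_lead1/G_lt3.
have ucs_lt3 c : c \in ucs -> all (gtn 3) c.
  by rewrite -(perm_mem xcolsG) => /mapP[j _ ->]; apply/all_normw/G_lt3.
have ucs_size c : c \in ucs -> size c = 5.
  by rewrite -(perm_mem xcolsG) => /mapP[j _ ->]; apply: size_N.
pose M := [seq [seq nth 0%N c i | c <- ucs] ++ drop 10 (nth [::] G i)
          | i <- iota 0 5].
have szM : size M = 5 by rewrite size_map.
have nthM i : (i < 5)%N ->
    nth [::] M i = [seq nth 0%N c i | c <- ucs] ++ drop 10 (nth [::] G i).
  by move=> lt_i; rewrite (nth_map 0%N) ?size_iota // nth_iota.
have colM j : (j < 10)%N -> digit_col M j = nth [::] ucs j.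
  move=> lt_j; apply: (@eq_from_nth _ 0%N).
    by rewrite size_map szM ucs_size ?mem_nth ?sz_ucs.
  rewrite size_map szM => i lt_i.
  rewrite nth_digit_col nthM // nth_cat size_map sz_ucs lt_j.
  by rewrite (nth_map [::]) ?sz_ucs.
have xcolsM : xcols M = ucs.
  apply: (@eq_from_nth _ [::]); rewrite size_map size_iota // => j lt_j.
  rewrite (nth_map 0%N) ?size_iota // nth_iota // colM // normw_id //.
  by apply/ucs_lead1/mem_nth; rewrite sz_ucs.
have dropM i : (i < 5)%N -> drop 10 (nth [::] M i) = drop 10 (nth [::] G i).
  by move=> lt_i; rewrite nthM // drop_size_cat // size_map.
have wtM (i : 'I_5) : wt10 (nth [::] M i) = wt (xpart (e (p i))).
  rewrite wt10_xcols ?szM // xcolsM -(seq.permP xcolsG) -wt10_xcols ?szG //.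
  rewrite nthG /row /norm_row; case: ifP => _;
    by rewrite ?wt10_oppw -wt_xpart digitsK.
exists G, M; split=> //.
  split; rewrite ?szM ?xcolsM //; left.
  apply: (@eq_from_nth _ (0, 0)%N).
    by rewrite !(size_map ydig) szG szM.
  rewrite (size_map ydig) szG => i lt_i.
  rewrite !(nth_map [::]) ?szG ?szM // /ydig.
  by rewrite -[10%N]addn0 -[11%N](addn1 10) -!nth_drop dropM.
split=> //.
- move=> i lt_i; apply/mapP.
  pose t := [seq nth 0%N c i | c <- cs] ++ drop 10 (nth [::] G i).
  have sz_t : size t = 7%N.
    rewrite size_cat (size_map _ cs) sz_cs size_drop (nthG (Ordinal lt_i)).
    rewrite /row /norm_row; case: ifP => _;
      by rewrite ?(size_map oppd) size_digits.
  exists t.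
    rewrite -{1}sz_t; apply: mem_tails; rewrite all_cat; apply/andP; split.
      apply/allP => _ /mapP[c cs_c ->].
      have /ucs_lt3 c_lt3 : c \in ucs by rewrite mem_cat cs_c orbT.
      have [lt_ic|le_ic] := ltnP i (size c); last by rewrite nth_default.
      exact: (allP c_lt3 _ (mem_nth 0%N lt_ic)).
    rewrite (nthG (Ordinal lt_i)) drop_norm_row all_normw //.
    by apply/allP => x /mem_drop; apply: (allP (all_digits _)).
  rewrite nthM // /ucs map_cat -catA; congr (_ ++ _).
  by case: i lt_i {t sz_t} => [|[|[|[|[|]]]]].
- move=> i lt_i; rewrite dropM // (nthG (Ordinal lt_i)) drop_norm_row.
  apply: normw_lead1; apply/allP => x /mem_drop.
  exact: (allP (all_digits _)).
- move=> k; rewrite /normal_cols.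
  have -> : [seq digit_col (take k M) j | j <- iota 5 5] = map (take k) cs.
    apply: (@eq_from_nth _ [::]); first by rewrite !size_map sz_cs size_iota.
    rewrite size_map size_iota => j lt_j.
    rewrite (nth_map 0%N) ?size_iota // nth_iota // (nth_map [::]) ?sz_cs //.
    by rewrite /digit_col map_take -/(digit_col M _) colM ?(ltn_add2l 5 _ 5) //.
  apply/andP; split.
    apply/allP => _ /mapP[c cs_c ->]; apply/lead1_take/ucs_lead1.
    by rewrite mem_cat cs_c orbT.
  rewrite sorted_map; apply: sub_sorted (sort_sorted lexle_total _) => c d.
  exact: lexle_take.
move=> i j /andP[le_ij lt_j]; have lt_i := leq_ltn_trans le_ij lt_j.
by rewrite (wtM (Ordinal lt_i)) (wtM (Ordinal lt_j)) p_wt.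
Qed.

(** * Search for the systematic matrices of admissible codes *)

Lemma code_of_rows_sub (G : seq (seq nat)) (U : {vspace word}) :
  {in G, forall u, word_of_digits u \in U} -> (code_of_rows G <= U)%VS.
Proof. by move=> GU; apply/span_subvP => _ /mapP[u Gu ->]; apply: GU. Qed.

Fixpoint spanw (G : seq (seq nat)) : seq (seq nat) :=
  match G with
  | [::] => [:: [::]]
  | r :: G' =>
      let S := spanw G' in S ++ map (addw r) S ++ map (addw (oppw r)) S
  end.

Lemma spanw_code G u : u \in spanw G -> word_of_digits u \in code_of_rows G.
Proof.
rewrite /code_of_rows; elim: G u => [|r G IHG] u /=.
  rewrite inE span_nil memv0 => /eqP ->.
  by apply/eqP/rowP => j; rewrite !mxE nth_nil.
rewrite span_cons !mem_cat => /or3P[Su|/mapP[v Sv ->]|/mapP[v Sv ->]].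
- by rewrite -[word_of_digits u]add0r memv_add ?mem0v ?IHG.
- by rewrite word_of_digitsD memv_add ?memv_line ?IHG.
- by rewrite word_of_digitsD word_of_digitsN memv_add ?memvN ?memv_line ?IHG.
Qed.

Definition row_cands (i : nat) : seq (seq nat) :=
  [seq r <- [seq unit5 i ++ t | t <- tails 7] | lead1 (drop 10 r) && okword r].

(** The rows are to be sorted by weight, so a candidate must not be lighter than
    the last row.  As the span is closed under opposites, the words [r + u] are,
    up to sign, all the words that [r] adds to it.  Binding the span outside the
    abstraction lets all candidates share it. *)
Definition extends (G : seq (seq nat)) : seq nat -> bool :=
  let S := spanw G in let w := wt10 (last [::] G) in
  fun r => (w <= wt10 r)%N && all (fun u => okword (addw r u)) S.

Section Search.
Variable leaf : seq (seq nat) -> bool.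

(** [G] holds the rows already chosen, [n] is the number of those to come, and
    the [j]-th entry of [cands] lists what is left for the [j]-th of these; a
    candidate that is incompatible with the rows chosen so far is dropped at
    once from all the lists. *)
Fixpoint search (n : nat) (G : seq (seq nat)) (cands : seq (seq (seq nat))) :=
  if n is n'.+1 then
    all (fun r =>
      let G' := rcons G r in
      normal_cols G' ==>
      (let ok := extends G' in
       search n' G' (map (filter ok) (behead cands)))) (head [::] cands)
  else leaf G.

(** The search meets [M] because no prefix of [M] fails a test and no later row
    of [M] is ever dropped. *)
Lemma search_sound (M : seq (seq nat)) :
  (forall k, normal_cols (take k M)) ->
  (forall k j, (k <= j < size M)%N -> extends (take k M) (nth [::] M j)) ->
  forall n k cands, (k + n)%N = size M ->
  (forall j, (j < n)%N -> nth [::] M (k + j) \in nth [::] cands j) ->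
  search n (take k M) cands -> leaf M.
Proof.
move=> normalM extM; elim=> [|n IHn] k cands /=.
  by rewrite addn0 => -> _; rewrite take_size.
move=> szM memM /allP searchM.
have lt_k : (k < size M)%N by rewrite -szM -addSnnS leq_addr.
have M_k := memM 0%N isT; rewrite addn0 -nth0 in searchM M_k.
have := searchM _ M_k; rewrite -take_nth // normalM /=.
apply: IHn => [|j lt_j]; first by rewrite addSnnS.
have := memM j.+1 lt_j; rewrite addnS -addSn -(nth_behead _ cands) => M_j.
have lt_jB : (j < size (behead cands))%N.
  by rewrite ltnNge; apply: contraTN M_j => le_j; rewrite (nth_default _ le_j).
rewrite (nth_map [::]) // mem_filter M_j andbT.
by apply: extM; rewrite leq_addr -szM addSn -addnS ltn_add2l ltnS.
Qed.
End Search.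

(** * Comparison with the seven codes *)

(** Looks in [S] for images of the rows [M], where [G] and [W] are the rows
    treated so far and their images; [flip] tells whether the [y]-columns are
    exchanged.  The multisets of columns have to agree already on the initial
    segments, which prunes the search.  The equality of weights follows from
    that of the columns but is cheaper to test. *)
Fixpoint embeds (flip : bool) (S G M W : seq (seq nat)) : bool :=
  if M is r :: M' then
    let G' := rcons G r in
    let cs := xcols G' in
    let y := if flip then swap_pair (ydig r) else ydig r in
    let n := wt10 r in
    has (fun w => let W' := rcons W w in
      [&& ydig w == y, wt10 w == n, perm_eq (xcols W') cs
        & embeds flip S G' M' W']) S
  else true.

Lemma embeds_sound flip S G M W :
  perm_eq (xcols G) (xcols W) -> embeds flip S G M W ->
  exists W', [/\ size W' = size M, {subset W' <= S},
    perm_eq (xcols (G ++ M)) (xcols (W ++ W')) &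
    map ydig W' = [seq if flip then swap_pair (ydig r) else ydig r | r <- M]].
Proof.
elim: M G W => [|r M IHM] G W eqGW /=.
  by exists [::]; split; rewrite ?cats0.
move=> /hasP[w Sw /and4P[/eqP y_w _ cols_w]].
rewrite perm_sym in cols_w => /(IHM _ _ cols_w)[W' [szW' subW' colsW' yW']].
exists (w :: W'); rewrite /= szW' y_w yW' -!cat_rcons; split=> // u.
by rewrite inE => /predU1P[-> // | /subW'].
Qed.

(** The numbers of words of weight 3 and 4 are (0,0), (0,18), (0,30), (4,8),
    (6,6), (8,10) and (12,18) for the seven codes in this order, so that the
    tally of a code tells in which of them an embedding is worth trying. *)
Definition tally (S : seq (seq nat)) : nat * nat :=
  (count (fun u => wt10 u == 3) S, count (fun u => wt10 u == 4) S)%N.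

(** The rows from which a code is defined, recovered from that definition. *)
Local Notation rows_of C :=
  ltac:(let D := eval unfold C in C in
        match D with code_of_rows ?rows => exact rows end) (only parsing).

Definition generators : seq (seq (seq nat)) :=
  [:: rows_of C12_1; rows_of C12_2; rows_of C12_3; rows_of C12_4;
      rows_of C12_5; rows_of C12_6; rows_of C12_7].

Definition targets : seq (seq (seq nat) * (nat * nat)) :=
  [seq let S := spanw G in (S, tally S) | G <- generators].

Definition listed (M : seq (seq nat)) : bool :=
  let t := tally (spanw M) in
  has (fun st => (st.2 == t) &&
    (embeds false st.1 [::] M [::] || embeds true st.1 [::] M [::])) targets.

(** The evaluation must be lazy, since a boolean connective evaluated by value
    would not cut any branch: it is left to the conversion test at [Qed]. *)
Lemma classification : search listed 5 [::] [seq row_cands i | i <- iota 0 5].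
Proof. exact_no_check (erefl true). Qed.

Lemma systematic_listed M : systematic M ->
  {in code_of_rows M, forall c, admissible c} -> listed M.
Proof.
move=> [szM rowM yM colsM wtM] admM.
have okM u : word_of_digits u \in code_of_rows M -> okword u.
  by move=> Mu; apply/admissible_okword/admM.
have memM i : (i < 5)%N -> nth [::] M i \in M.
  by move=> lt_i; rewrite mem_nth ?szM.
have codeM r : r \in M -> word_of_digits r \in code_of_rows M.
  by move=> Mr; apply/memv_span/map_f.
have := @search_sound listed M colsM _ 5 0 [seq row_cands i | i <- iota 0 5].
rewrite take0 => sound; apply: sound classification.
- move=> k j /andP[le_kj]; rewrite szM => lt_j; apply/andP; split.
    case: k le_kj => [_|k lt_kj]; first by rewrite take0.
    rewrite (take_nth [::]) ?szM ?(ltn_trans lt_kj) // last_rcons.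
    by apply: wtM; rewrite (ltnW lt_kj).
  apply/allP => u Su; apply: okM; rewrite word_of_digitsD memvD //.
    by rewrite codeM ?memM.
  have /subvP : (code_of_rows (take k M) <= code_of_rows M)%VS.
    by apply: code_of_rows_sub => r /mem_take; apply: codeM.
  by apply; apply: spanw_code.
- by rewrite szM.
move=> j lt_j; rewrite add0n (nth_map 0%N) ?size_iota // nth_iota // mem_filter.
by rewrite rowM // yM // okM // codeM // memM.
Qed.

Lemma generators_size G : G \in generators -> size G = 5%N.
Proof. by rewrite !inE => /or4P[||| /or4P[]] /eqP ->. Qed.

Lemma listed_equiv M : size M = 5%N -> listed M ->
  exists2 T, T \in generators & exists W,
    [/\ size W = 5%N,
        {in W, forall w, word_of_digits w \in code_of_rows T}
      & rows_equiv M W].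
Proof.
move=> szM /hasP[_ /mapP[T genT ->] /andP[_ /=]] emb; exists T => //.
have refl0 : perm_eq (xcols [::]) (xcols [::]) by [].
case/orP: emb => /(embeds_sound refl0)[W [szW subW colsW yW]]; exists W;
  split=> [|w /subW /spanw_code //|]; rewrite ?szW //; split=> //.
  by left.
right; rewrite (map_comp swap_pair) yW -map_comp.
by apply: eq_map => r; case: r => *; rewrite /swap_pair.
Qed.

(** * Classification *)

Theorem theorem1 (C : {vspace word})
  (dimC : \dim C = 5%N)
  (C_i : forall c : word, c \in C ->
     (wt (xpart c))%:R = ypart c 0 0 * ypart c 0 1 :> F3)
  (C_ii : forall c : word, c \in C -> c != 0 -> (3 <= wt (xpart c))%N)
  (C_iii : forall c : word, c \in C -> wt (xpart c) = 3%N ->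
     (ypart c 0 0, ypart c 0 1) <> (0, 0)) :
  [\/ SZ_equiv C C12_1, SZ_equiv C C12_2, SZ_equiv C C12_3 |
    [\/ SZ_equiv C C12_4, SZ_equiv C C12_5, SZ_equiv C C12_6 |
      SZ_equiv C C12_7]].
Proof.
have admC : {in C, forall c, admissible c}.
  move=> c Cc; split; [exact: C_i | exact: C_ii |] => wt3.
  by apply: contra_not_neq (C_iii c Cc wt3) => ->; rewrite !mxE.
have xinj c : c \in C -> xpart c = 0 -> c = 0.
  move=> Cc c0; apply/eqP; apply: contraT => /(C_ii c Cc).
  suff -> : wt (xpart c) = 0%N by [].
  apply/eqP; rewrite c0 /wt cards_eq0; apply/eqP/setP => i.
  by rewrite !inE mxE eqxx.
have [G [M [CG eqGM sysM]]] := systematic_form dimC xinj.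
have listM : listed M.
  apply: systematic_listed => //; apply: admissible_SZ_equiv admC.
  by rewrite CG; apply: rows_equiv_SZ.
have [T genT [W [szW WT eqMW]]] := listed_equiv (systematic_size sysM) listM.
have eqGW := rows_equiv_trans eqGM eqMW.
have CW : SZ_equiv C (code_of_rows W) by rewrite CG; apply: rows_equiv_SZ.
(* The span of [W] is contained in that of [T], and has the dimension of [C]. *)
have eqWT : code_of_rows W = code_of_rows T.
  apply/eqP; rewrite eqEdim code_of_rows_sub //=.
  apply: leq_trans (dim_span _) _; rewrite size_map generators_size //.
  have := SZ_equiv_dim (rows_equiv_SZ (rows_equiv_sym eqGW)).
  by rewrite -CG dimC.
rewrite {}eqWT in CW; move: genT CW; rewrite !inE.
move=> /or4P[||| /or4P[]] /eqP -> CW.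
- by constructor 1.
- by constructor 2.
- by constructor 3.
- by constructor 4; constructor 1.
- by constructor 4; constructor 2.
- by constructor 4; constructor 3.
- by constructor 4; constructor 4.
Qed.
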